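(* Let $w:\mathbb R\to(-\infty,0]$ satisfy Assumption (A) given in the context, with $\operatorname{supp} w=[-s_w,s_w]$. Then, whenever $0<\ell<\frac{1}{4s_w}$, the point of linear stability $$\gamma_\sharp=\gamma_\sharp(\ell):=-\frac{1}{\min_{k\in 2\pi\mathbb Z\setminus\{0\}}\widehat W_{1,\ell}(k)}$$ equals $$\gamma_\sharp=-\frac{1}{\widehat W_{1,\ell}(2\pi)}.$$ Moreover, $$\gamma_\sharp\sim\frac{1}{m_w}\,\ell^{-2}\quad\text{as }\ell\downarrow 0,\qquad\text{where } m_w:=-\int_{\mathbb R}w(x)\,dx>0.$$
   Context: Assumption (A) on $w:\mathbb R\to(-\infty,0]$: (i) $w$ is even, Lipschitz continuous, and non-decreasing on $[0,\infty)$; (ii) $w$ has compact support, there is $s_w\in[0,\infty)$ with $\operatorname{supp}w=[-s_w,s_w]$, and $w\le 0$; (iii) $w$ is $C^2$ in a neighbourhood of $0$ and attains its global minimum at $0$, with $w''(0)>0$. For $\gamma,\ell>0$ the interaction potential is $W_{\gamma,\ell}(x):=\gamma\,\ell\,w(x/\ell)$ for $|x|<\tfrac12$, extended $1$-periodically to $\mathbb R$. For $k\in 2\pi\mathbb Z$, $\widehat W_{\gamma,\ell}(k):=\int_0^1W_{\gamma,\ell}(x)\cos(kx)\,dx$; here $\widehat W_{1,\ell}$ denotes this with $\gamma=1$. The notation $f\sim g$ means that the ratio $f/g$ tends to $1$ in the indicated limit. *)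

(* Defs.v *)
From Stdlib Require Import Reals ZArith.
From Coquelicot Require Import Coquelicot.
Open Scope R_scope.

Definition support (f : R -> R) : R -> Prop := adherence (fun x => f x <> 0).

Record assumption_A (w : R -> R) (s_w : R) : Prop := {
  A_even : forall x, w (- x) = w x;
  A_lipschitz : exists L, forall x y, Rabs (w x - w y) <= L * Rabs (x - y);
  A_nondecreasing : forall x y, 0 <= x -> x <= y -> w x <= w y;
  A_compact_support : compact (support w);
  A_radius_nonneg : 0 <= s_w;
  A_support : forall x, support w x <-> - s_w <= x <= s_w;
  A_nonpos : forall x, w x <= 0;
  A_C2_near_0 : locally 0 (fun x =>
    ex_derive w x /\ ex_derive_n w 2 x /\ continuous (Derive_n w 2) x);
  A_min_at_0 : forall x, w 0 <= w x;
  A_second_derivative : 0 < Derive_n w 2 0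
}.

(** [x - IZR (Int_part (x + 1 / 2))] is the representative of [x] modulo 1
    in [[-1/2, 1/2)]. Half-integers, where the formula on [|x| < 1/2] says
    nothing, receive the value of [f] at [-1/2]. *)
Definition periodize (f : R -> R) (x : R) : R :=
  f (x - IZR (Int_part (x + 1 / 2))).

Definition W (w : R -> R) (gamma l : R) : R -> R :=
  periodize (fun x => gamma * l * w (x / l)).

Definition W_hat (w : R -> R) (gamma l k : R) : R :=
  RInt (fun x => W w gamma l x * cos (k * x)) 0 1.

Definition nonzero_frequency (k : R) : Prop :=
  exists n : Z, n <> 0%Z /\ k = 2 * PI * IZR n.

Definition is_minimum (E : R -> Prop) (m : R) : Prop :=
  E m /\ forall x, E x -> m <= x.

(** [iota P] is the unique element satisfying [P], when there is one. *)
Definition minimum (E : R -> Prop) : R := iota (is_minimum E).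

Definition nonzero_modes (w : R -> R) (l : R) : R -> Prop :=
  fun v => exists k, nonzero_frequency k /\ v = W_hat w 1 l k.

Definition gamma_sharp (w : R -> R) (l : R) : R :=
  - (1 / minimum (nonzero_modes w l)).

Definition m_w (w : R -> R) : R :=
  - RInt_gen w (Rbar_locally m_infty) (Rbar_locally p_infty).

Definition asymp_equiv (F : (R -> Prop) -> Prop) (f g : R -> R) : Prop :=
  filterlim (fun x => f x / g x) F (locally 1).

(* Main.v *)
Require Import Defs.
From Stdlib Require Import Reals ZArith Lra Lia.
From Coquelicot Require Import Coquelicot.
Open Scope R_scope.

(** Rescaling [x = l y] and using that [w] is even and supported in
    [[- s_w, s_w]] turns every mode into
      [W_hat w 1 l (2 PI n) = 2 l^2 J (2 PI n l)]
    with [J = cos_moment w s_w], [J a] being the integral of [w y cos (a y)]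
    over [[0, s_w]]
    ([W_hat_cos_moment]). With [a = 2 PI l], the assumption [l < 1 / (4 s_w)]
    says exactly that [a y] stays below [PI / 2] on the support. Everything is
    read off from [J].

    The fundamental mode is the smallest: it must be shown that
    [J a <= J (n a)], that is, that [- w] integrates to a nonnegative number
    against [g y = cos (a y) - cos (n a y)]. The function [g] changes sign, but
    its primitive [sin (a y) / a - sin (n a y) / (n a)] is nonnegative, because
    [|sin (n t)| <= |n| |sin t|] ([Rabs_sin_IZR_mult_le]) and [sin (a y) >= 0].
    Since [- w] is nonnegative and nonincreasing, integrating by parts gives
    the sign ([RInt_nonincreasing_mult_ge0], [cos_moment_multiple_ge]). The
    minimum is negative because [cos (a y) > 0] and [w y < 0] in the interior
    of the support ([cos_moment_neg]).

    For the asymptotics, [m_w w = - 2 J 0] ([m_w_cos_moment]), so the ratio of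
    [gamma_sharp w l] to [l^-2 / m_w w] is [J 0 / J (2 PI l)], and [J] is
    continuous at [0] ([cos_moment_continuous_0]). *)

(** * Trigonometric inequalities *)

(** Induction through the addition formula, all cosines being at most [1];
    both sides are even in [n]. *)
Lemma Rabs_sin_IZR_mult_le (n : Z) (t : R) :
  Rabs (sin (IZR n * t)) <= Rabs (IZR n) * Rabs (sin t).
Proof.
assert (Hnat : forall m : nat,
  Rabs (sin (INR m * t)) <= INR m * Rabs (sin t)).
{ induction m as [|m IH].
  - simpl; rewrite Rmult_0_l, sin_0, Rabs_R0; lra.
  - rewrite S_INR, Rmult_plus_distr_r, Rmult_1_l, sin_plus.
    eapply Rle_trans; [apply Rabs_triang|].
    rewrite !Rabs_mult.
    assert (Hc1 : Rabs (cos t) <= 1) by (apply Rabs_le, COS_bound).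
    assert (Hc2 : Rabs (cos (INR m * t)) <= 1) by (apply Rabs_le, COS_bound).
    pose proof (Rabs_pos (sin t)); pose proof (Rabs_pos (sin (INR m * t))).
    nra. }
destruct (Z_le_gt_dec 0 n) as [Hn|Hn].
- specialize (Hnat (Z.to_nat n)).
  rewrite INR_IZR_INZ, Z2Nat.id in Hnat by lia.
  rewrite (Rabs_pos_eq (IZR n)); [exact Hnat | now apply IZR_le].
- specialize (Hnat (Z.to_nat (- n))).
  rewrite INR_IZR_INZ, Z2Nat.id, opp_IZR, Ropp_mult_distr_l_reverse, sin_neg,
    Rabs_Ropp in Hnat by lia.
  rewrite (Rabs_left (IZR n)); [exact Hnat | apply IZR_lt; lia].
Qed.

(** From [1 - cos x = 2 (sin (x / 2))^2]. *)
Lemma Rabs_cos_minus_1_le (x : R) : Rabs (cos x - 1) <= x * x / 2.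
Proof.
assert (Hsin : forall y, 0 <= y -> Rabs (sin y) <= y).
{ intros y [Hy| <-]; [|rewrite sin_0, Rabs_R0; lra].
  apply Rabs_le; split; [|left; now apply sin_lt_x].
  destruct (Rle_dec y 1) as [H1|H1].
  - assert (0 <= sin y) by (apply sin_ge_0; generalize PI2_1; lra). lra.
  - generalize (SIN_bound y); lra. }
assert (Hs : Rabs (sin (x / 2)) <= Rabs (x / 2)).
{ unfold Rabs at 2; destruct (Rcase_abs (x / 2)).
  - rewrite <- Rabs_Ropp, <- sin_neg; apply Hsin; lra.
  - apply Hsin; lra. }
apply Rsqr_le_abs_1 in Hs; unfold Rsqr in Hs.
replace (cos x) with (cos (2 * (x / 2))) by (f_equal; field).
rewrite cos_2a_sin, Rabs_left1 by nra.
nra.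
Qed.

(** * Integrals *)

(** [RInt_correct] at [R] only: with the module structure fixed, unification
    has no choice to make. *)
Lemma is_RInt_RInt (f : R -> R) (a b : R) :
  ex_RInt f a b -> is_RInt f a b (RInt f a b).
Proof. exact (@RInt_correct R_CompleteNormedModule f a b). Qed.

(** Formally [int f g = f(s) G(s) - int G df] with [G] the primitive of [g], and
    both terms are nonnegative when [G >= 0] and [f] is nonnegative and
    nonincreasing. To avoid differentiating [f], the Stieltjes term is written
    as [F s] with [F t = int_0^t f g - f(t) G(t)], which loses at most
    [(f(a) - f(b)) M (b - a)] on a step [[a, b]]. On a uniform subdivision in
    [N] steps the losses telescope to [(f(0) - f(s)) M s / N], so [F s >= 0]. *)
Lemma RInt_nonincreasing_mult_ge0 (f g : R -> R) (s M : R) :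
  0 <= s ->
  (forall x y, 0 <= x -> x <= y -> y <= s -> f y <= f x) ->
  0 <= f s ->
  (forall x, 0 <= x <= s -> Rabs (g x) <= M) ->
  ex_RInt f 0 s -> ex_RInt g 0 s -> ex_RInt (fun x => f x * g x) 0 s ->
  (forall x, 0 <= x <= s -> 0 <= RInt g 0 x) ->
  0 <= RInt (fun x => f x * g x) 0 s.
Proof.
intros Hs Hf Hfs HM If Ig Ifg HG.
assert (sub : forall h a b, ex_RInt h 0 s -> 0 <= a -> a <= b -> b <= s ->
  @ex_RInt R_NormedModule h a b).
{ intros h a b Hh Ha Hab Hb.
  apply @ex_RInt_Chasles_2 with 0; [lra|].
  apply @ex_RInt_Chasles_1 with s; [lra|exact Hh]. }
set (F := fun t => RInt (fun x => f x * g x) 0 t - f t * RInt g 0 t).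
assert (step : forall a b, 0 <= a -> a <= b -> b <= s ->
  F a - (f a - f b) * M * (b - a) <= F b).
{ intros a b Ha Hab Hb; unfold F.
  rewrite <- (RInt_Chasles (fun x => f x * g x) 0 a b) by (apply sub; auto; lra).
  rewrite <- (RInt_Chasles g 0 a b) by (apply sub; auto; lra).
  unfold plus; simpl.
  (* The increment of [F] is [int_a^b (f - f(b)) g + (f(a) - f(b)) G(a)], whose
     last term is nonnegative. *)
  assert (HI : RInt (fun x => - ((f a - f b) * M)) a b <=
    RInt (fun x => f x * g x) a b - f b * RInt g a b).
  { assert (ID : is_RInt (fun x => f x * g x - f b * g x) a b
      (RInt (fun x => f x * g x) a b - f b * RInt g a b)).
    { apply (is_RInt_minus (V := R_NormedModule)).
      - apply is_RInt_RInt, sub; auto.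
      - apply (is_RInt_scal (V := R_NormedModule)), is_RInt_RInt, sub; auto. }
    rewrite <- (is_RInt_unique _ _ _ _ ID).
    apply RInt_le; [lra | apply ex_RInt_const | eexists; exact ID |].
    - intros x Hx.
      assert (Hgx := HM x ltac:(lra)); apply Rabs_le_between in Hgx.
      assert (H1 := Hf a x ltac:(lra) ltac:(lra) ltac:(lra)).
      assert (H2 := Hf x b ltac:(lra) ltac:(lra) ltac:(lra)).
      nra. }
  rewrite RInt_const in HI; unfold scal in HI; simpl in HI; unfold mult in HI;
    simpl in HI.
  assert (H1 := Hf a b ltac:(lra) ltac:(lra) ltac:(lra)).
  assert (H2 := HG a ltac:(lra)).
  nra. }
assert (F0 : F 0 = 0).
{ unfold F; rewrite !RInt_point; unfold zero; simpl; ring. }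
assert (Hbound : forall N : nat, (0 < N)%nat ->
  - ((f 0 - f s) * M * (s / INR N)) <= F s).
{ intros N HN.
  assert (HN' : 0 < INR N) by now apply lt_0_INR.
  set (h := s / INR N).
  assert (Hh : 0 <= h) by (apply Rdiv_le_0_compat; lra).
  assert (HNh : INR N * h = s) by (unfold h; field; lra).
  assert (Hk : forall k : nat, (k <= N)%nat ->
    - ((f 0 - f (INR k * h)) * M * h) <= F (INR k * h)).
  { induction k as [|k IH]; intros Hk.
    - simpl; rewrite Rmult_0_l, F0; lra.
    - specialize (IH ltac:(lia)).
      assert (HkN : INR (S k) <= INR N) by now apply le_INR.
      assert (Hk0 := pos_INR k).
      rewrite S_INR in *.
      assert (St := step (INR k * h) ((INR k + 1) * h)
        ltac:(nra) ltac:(nra) ltac:(nra)).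
      replace ((INR k + 1) * h - INR k * h) with h in St by ring.
      lra. }
  specialize (Hk N (le_n N)); rewrite HNh in Hk; exact Hk. }
(* A negative [F s] is beaten by the bound for [N] larger than
   [|C| / - F s]. *)
assert (HFs : 0 <= F s).
{ destruct (Rle_dec 0 (F s)) as [H|H]; [exact H|exfalso].
  apply Rnot_le_lt in H.
  set (C := (f 0 - f s) * M * s).
  destruct (nfloor_ex (Rabs C / - F s)) as [N [_ HN]].
  { apply Rdiv_le_0_compat; [apply Rabs_pos | lra]. }
  specialize (Hbound (S N) ltac:(lia)).
  assert (HN0 := pos_INR N).
  rewrite S_INR in Hbound.
  replace ((f 0 - f s) * M * (s / (INR N + 1))) with (C / (INR N + 1)) in Hbound
    by (unfold C; field; lra).
  apply Rlt_div_l in HN; [|lra].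
  assert (HC : C < (INR N + 1) * - F s) by (generalize (Rle_abs C); lra).
  rewrite Rmult_comm in HC; apply Rlt_div_l in HC; lra. }
unfold F in HFs.
assert (H := HG s ltac:(lra)).
nra.
Qed.

Lemma is_RInt_even_sym (f : R -> R) (s : R) :
  (forall x, f (- x) = f x) -> ex_RInt f 0 s ->
  is_RInt f (- s) s (2 * RInt f 0 s).
Proof.
intros Hf If.
assert (H := is_RInt_RInt f 0 s If).
replace (2 * RInt f 0 s) with (plus (RInt f 0 s) (RInt f 0 s))
  by (unfold plus; simpl; ring).
apply @is_RInt_Chasles with 0; [|exact H].
replace (RInt f 0 s) with (opp (opp (RInt f 0 s))) by apply opp_opp.
apply (is_RInt_swap (V := R_NormedModule)).
apply (is_RInt_ext (fun x => scal (-1) (scal (-1) (f (-1 * x + 0))))).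
- intros x _; rewrite <- (Hf x); unfold scal; simpl; unfold mult; simpl.
  replace (-1 * x + 0) with (- x) by ring; ring.
- replace (opp (RInt f 0 s)) with (scal (-1) (RInt f 0 s))
    by (unfold scal, opp; simpl; unfold mult; simpl; ring).
  apply (is_RInt_scal (V := R_NormedModule)).
  apply (is_RInt_comp_lin (V := R_NormedModule) f (-1) 0 0 (- s)).
  replace (-1 * 0 + 0) with 0 by ring; replace (-1 * - s + 0) with s by ring.
  exact H.
Qed.

Lemma is_RInt_cos_scaled (a y : R) :
  a <> 0 -> is_RInt (fun t => cos (a * t)) 0 y (sin (a * y) / a).
Proof.
intros Ha.
replace (sin (a * y) / a) with
  (minus (sin (a * y) / a) (sin (a * 0) / a) : R).
2:{ rewrite Rmult_0_r, sin_0; unfold minus, plus, opp; simpl; field; exact Ha. }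
apply (is_RInt_derive (V := R_CompleteNormedModule) (fun t => sin (a * t) / a)).
- intros x _; auto_derive; trivial; field; exact Ha.
- intros x _; apply (ex_derive_continuous (fun y => cos (a * y))).
  auto_derive; trivial.
Qed.

(** * Periodicity *)

Lemma periodize_shift (f : R -> R) (x : R) (n : Z) :
  - / 2 <= x < / 2 -> periodize f (x + IZR n) = f x.
Proof.
intros Hx; unfold periodize.
rewrite <- (Int_part_spec (x + IZR n + 1 / 2) n) by lra.
f_equal; ring.
Qed.

Lemma cos_period_Z (n : Z) (x : R) : cos (x + 2 * PI * IZR n) = cos x.
Proof.
destruct (Z_le_gt_dec 0 n) as [Hn|Hn].
- rewrite <- (cos_period x (Z.to_nat n)), INR_IZR_INZ, Z2Nat.id by lia.
  f_equal; ring.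
- rewrite <- (cos_period (x + 2 * PI * IZR n) (Z.to_nat (- n))).
  rewrite INR_IZR_INZ, Z2Nat.id, opp_IZR by lia; f_equal; ring.
Qed.

(** * Consequences of the assumptions on the profile *)

Lemma A_continuous (w : R -> R) (s : R) (hw : assumption_A w s) (x : R) :
  continuous w x.
Proof.
destruct (A_lipschitz w s hw) as [L HL].
apply filterlim_locally; intros eps.
assert (HK : 0 < Rabs L + 1) by (generalize (Rabs_pos L); lra).
exists (mkposreal (eps / (Rabs L + 1)) (Rdiv_lt_0_compat _ _ (cond_pos eps) HK)).
intros y Hy; change (Rabs (y - x) < eps / (Rabs L + 1)) in Hy.
change (Rabs (w y - w x) < eps).
apply Rlt_div_r in Hy; [|lra].
generalize (HL y x) (Rle_abs L) (Rabs_pos (y - x)); nra.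
Qed.

Lemma A_zero_outside (w : R -> R) (s : R) (hw : assumption_A w s) (x : R) :
  s < x -> w x = 0.
Proof.
intros Hx.
destruct (Req_dec (w x) 0) as [H|H]; [exact H|exfalso].
assert (Hsup : support w x).
{ intros V [d Hd]; exists x; split; [|exact H].
  apply Hd; unfold disc; rewrite Rminus_diag, Rabs_R0; apply cond_pos. }
apply (A_support w s hw) in Hsup; lra.
Qed.

(** If [w] vanished at some [x < s], monotonicity and [w <= 0] would make it
    vanish beyond [x], so that [s] would not be in the support. *)
Lemma A_neg_inside (w : R -> R) (s : R) (hw : assumption_A w s) (x : R) :
  0 <= x < s -> w x < 0.
Proof.
intros Hx.
destruct (A_nonpos w s hw x) as [H|H]; [exact H|exfalso].
assert (Hs : support w s) by (apply (A_support w s hw); lra).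
destruct (Hs (fun y => Rabs (y - s) < s - x)) as [y [Hy Hwy]].
{ exists (mkposreal (s - x) ltac:(lra)); intros y Hy; exact Hy. }
apply Rabs_def2 in Hy.
apply Hwy, Rle_antisym; [apply (A_nonpos w s hw)|].
rewrite <- H; apply (A_nondecreasing w s hw); lra.
Qed.

(** For [s = 0] the function [w] would vanish off [0], hence everywhere by
    continuity; but then its support would be empty, not [{0}]. *)
Lemma A_radius_pos (w : R -> R) (s : R) (hw : assumption_A w s) : 0 < s.
Proof.
destruct (A_radius_nonneg w s hw) as [H|H]; [exact H|exfalso].
assert (Hz : forall x, x <> 0 -> w x = 0).
{ intros x Hx; destruct (Rlt_le_dec 0 x).
  - apply (A_zero_outside w s hw); lra.
  - rewrite <- (A_even w s hw); apply (A_zero_outside w s hw); lra. }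
assert (H0 : w 0 <> 0).
{ intros H0.
  assert (Hs : support w 0) by (apply (A_support w s hw); lra).
  destruct (Hs (fun _ => True)) as [y [_ Hy]].
  { exists (mkposreal 1 Rlt_0_1); intros y _; exact I. }
  destruct (Req_dec y 0) as [->|Hy0]; auto. }
assert (Hlim := A_continuous w s hw 0).
apply filterlim_locally with (eps := mkposreal _ (Rabs_pos_lt _ H0)) in Hlim.
destruct Hlim as [d Hd].
assert (Hd2 := cond_pos d).
specialize (Hd (d / 2)).
change (Rabs (d / 2 - 0) < d -> Rabs (w (d / 2) - w 0) < Rabs (w 0)) in Hd.
rewrite (Hz (d / 2)), Rminus_0_l, Rabs_Ropp, Rminus_0_r, Rabs_pos_eq in Hd
  by lra.
lra.
Qed.

(** * Cosine moments of the profile *)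

(** For an even [w] supported in [[- s, s]], half of its Fourier transform at
    frequency [a]. *)
Definition cos_moment (w : R -> R) (s a : R) : R :=
  RInt (fun y => w y * cos (a * y)) 0 s.

Lemma A_continuous_mode (w : R -> R) (s : R) (hw : assumption_A w s) (a x : R) :
  continuous (fun y => w y * cos (a * y)) x.
Proof.
apply (continuous_mult w (fun y => cos (a * y))).
- apply (A_continuous w s hw).
- apply (ex_derive_continuous (fun y => cos (a * y))); auto_derive; trivial.
Qed.

Lemma A_ex_RInt_mode (w : R -> R) (s : R) (hw : assumption_A w s) (a b c : R) :
  ex_RInt (fun y => w y * cos (a * y)) b c.
Proof.
apply (ex_RInt_continuous (V := R_CompleteNormedModule)).
intros x _; now apply (A_continuous_mode w s hw).
Qed.

Lemma A_cos_moment_extend (w : R -> R) (s : R) (hw : assumption_A w s) (a t : R) :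
  s <= t -> RInt (fun y => w y * cos (a * y)) 0 t = cos_moment w s a.
Proof.
intros Ht.
rewrite <- (RInt_Chasles _ 0 s t) by now apply (A_ex_RInt_mode w s hw).
rewrite (RInt_ext _ (fun _ => 0) s t).
- rewrite RInt_const; unfold cos_moment, plus, scal; simpl; unfold mult; simpl.
  ring.
- rewrite Rmin_left by lra; intros x [Hx _].
  rewrite (A_zero_outside w s hw x Hx); apply Rmult_0_l.
Qed.

(** Over [[0, 1/2]] the integrand is the rescaled profile itself. Over
    [[1/2, 1]] it is the profile translated by [1], and [cos (k x)] is invariant
    under this translation since [k] is a multiple of [2 PI]; so this half is
    the integral over [[-1/2, 0]], which equals the first one by evenness. The
    condition [l * s <= 1/2] keeps the whole support inside one period. *)
Lemma W_hat_cos_moment (w : R -> R) (s : R) (hw : assumption_A w s)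
    (l : R) (n : Z) :
  0 < l -> l * s <= / 2 ->
  W_hat w 1 l (2 * PI * IZR n) =
    2 * (l * l) * cos_moment w s (2 * PI * IZR n * l).
Proof.
intros Hl Hls.
set (k := 2 * PI * IZR n).
set (f := fun x => l * (w (x / l) * cos (k * x))).
assert (Hfeq : forall x, f x =
  scal (l * l) (scal (/ l) ((fun y => w y * cos (k * l * y)) (/ l * x + 0)))).
{ intros x; unfold f, scal; simpl; unfold mult; simpl.
  replace (/ l * x + 0) with (x / l) by (field; lra).
  replace (k * l * (x / l)) with (k * x) by (field; lra).
  field; lra. }
assert (Hhalf : is_RInt f 0 (/ 2) (l * l * cos_moment w s (k * l))).
{ apply (is_RInt_ext (fun x => scal (l * l)
    (scal (/ l) ((fun y => w y * cos (k * l * y)) (/ l * x + 0))))).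
  { intros x _; now rewrite Hfeq. }
  apply (is_RInt_scal (V := R_NormedModule)).
  apply (is_RInt_comp_lin (V := R_NormedModule)
    (fun y => w y * cos (k * l * y)) (/ l) 0 0 (/ 2)).
  replace (/ l * 0 + 0) with 0 by ring.
  rewrite <- (A_cos_moment_extend w s hw (k * l) (/ l * / 2 + 0)).
  - apply is_RInt_RInt, (A_ex_RInt_mode w s hw).
  - rewrite Rplus_0_r, Rmult_comm; apply Rle_div_r; lra. }
assert (Hsym : is_RInt f (- / 2) (/ 2) (2 * (l * l * cos_moment w s (k * l)))).
{ rewrite <- (is_RInt_unique _ _ _ _ Hhalf).
  apply is_RInt_even_sym; [|eexists; exact Hhalf].
  intros x; unfold f.
  replace (- x / l) with (- (x / l)) by (field; lra).
  replace (k * - x) with (- (k * x)) by ring.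
  now rewrite (A_even w s hw), cos_neg. }
assert (Hneg : is_RInt f (- / 2) 0 (l * l * cos_moment w s (k * l))).
{ replace (l * l * cos_moment w s (k * l)) with
    (plus (2 * (l * l * cos_moment w s (k * l)))
          (opp (l * l * cos_moment w s (k * l))))
    by (unfold plus, opp; simpl; ring).
  apply @is_RInt_Chasles with (/ 2); [exact Hsym|].
  now apply (is_RInt_swap (V := R_NormedModule)). }
unfold W_hat; apply is_RInt_unique.
replace (2 * (l * l) * cos_moment w s (k * l)) with
  (plus (l * l * cos_moment w s (k * l)) (l * l * cos_moment w s (k * l)))
  by (unfold plus; simpl; ring).
apply @is_RInt_Chasles with (/ 2).
- apply (is_RInt_ext f); [|exact Hhalf].
  rewrite Rmin_left, Rmax_right by lra; intros x Hx.
  unfold W; rewrite <- (Rplus_0_r x) at 2.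
  rewrite (periodize_shift _ x 0) by lra.
  unfold f.
  change (@eq R (l * (w (x / l) * cos (k * x)))
    (1 * l * w (x / l) * cos (k * x))); ring.
- apply (is_RInt_ext (fun x => scal 1 (f (1 * x + -1)))).
  + rewrite Rmin_left, Rmax_right by lra; intros x Hx.
    unfold scal; simpl; unfold mult; simpl.
    unfold W; replace x with ((1 * x + -1) + IZR 1) at 2 by ring.
    rewrite (periodize_shift _ (1 * x + -1) 1) by lra.
    unfold f, k.
    rewrite <- (cos_period_Z n (2 * PI * IZR n * (1 * x + -1))).
    replace (2 * PI * IZR n * (1 * x + -1) + 2 * PI * IZR n)
      with (2 * PI * IZR n * x) by ring.
    ring.
  + apply (is_RInt_comp_lin (V := R_NormedModule) f 1 (-1) (/ 2) 1).
    replace (1 * / 2 + -1) with (- / 2) by field.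
    replace (1 * 1 + -1) with 0 by ring.
    exact Hneg.
Qed.

(** [RInt_nonincreasing_mult_ge0] with [f = - w] and
    [g y = cos (a y) - cos (n a y)]. The condition [a s <= PI] makes
    [sin (a y) >= 0], so that [sin (n a y) / n <= sin (a y)] and the primitive
    of [g] is nonnegative. *)
Lemma cos_moment_multiple_ge (w : R -> R) (s : R) (hw : assumption_A w s)
    (a : R) (n : Z) :
  0 < a -> a * s <= PI -> n <> 0%Z ->
  cos_moment w s a <= cos_moment w s (a * IZR n).
Proof.
intros Ha Has Hn.
assert (Hs := A_radius_pos w s hw).
assert (Hn0 : IZR n <> 0) by now apply not_0_IZR.
set (g := fun y => cos (a * y) - cos (a * IZR n * y)).
assert (Ig : forall y, is_RInt g 0 y
  (sin (a * y) / a - sin (a * IZR n * y) / (a * IZR n))).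
{ intros y; apply (is_RInt_minus (V := R_NormedModule)).
  - apply is_RInt_cos_scaled; lra.
  - apply is_RInt_cos_scaled, Rmult_integral_contrapositive_currified; lra. }
assert (Iw : ex_RInt w 0 s).
{ apply (ex_RInt_continuous (V := R_CompleteNormedModule)).
  intros; now apply (A_continuous w s hw). }
assert (Ifg : is_RInt (fun y => - w y * g y) 0 s
  (cos_moment w s (a * IZR n) - cos_moment w s a)).
{ apply (is_RInt_ext (fun y => minus (w y * cos (a * IZR n * y))
                                     (w y * cos (a * y)))).
  { intros y _; unfold g, minus, plus, opp; simpl; ring. }
  apply (is_RInt_minus (V := R_NormedModule)); apply is_RInt_RInt;
    now apply (A_ex_RInt_mode w s hw). }
cut (0 <= RInt (fun y => - w y * g y) 0 s).
{ rewrite (is_RInt_unique _ _ _ _ Ifg); lra. }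
apply (RInt_nonincreasing_mult_ge0 (fun y => - w y) g s 2).
- lra.
- intros x y Hx Hxy _.
  generalize (A_nondecreasing w s hw x y Hx Hxy); lra.
- generalize (A_nonpos w s hw s); lra.
- intros x _; unfold g; apply Rabs_le.
  generalize (COS_bound (a * x)) (COS_bound (a * IZR n * x)); lra.
- now apply (ex_RInt_opp (V := R_NormedModule)).
- eexists; apply Ig.
- eexists; exact Ifg.
- intros y Hy; rewrite (is_RInt_unique _ _ _ _ (Ig y)).
  assert (Hsin : 0 <= sin (a * y)) by (apply sin_ge_0; nra).
  assert (Hle := Rabs_sin_IZR_mult_le n (a * y)).
  replace (IZR n * (a * y)) with (a * IZR n * y) in Hle by ring.
  rewrite (Rabs_pos_eq (sin (a * y))) in Hle by exact Hsin.
  assert (Hq : sin (a * IZR n * y) / IZR n <= sin (a * y)).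
  { eapply Rle_trans; [apply Rle_abs|].
    rewrite Rabs_div by exact Hn0.
    apply Rle_div_l; [now apply Rabs_pos_lt|lra]. }
  replace (sin (a * y) / a - sin (a * IZR n * y) / (a * IZR n))
    with ((sin (a * y) - sin (a * IZR n * y) / IZR n) / a)
    by (field; split; lra).
  apply Rdiv_le_0_compat; lra.
Qed.

Lemma cos_moment_neg (w : R -> R) (s : R) (hw : assumption_A w s) (a : R) :
  0 <= a -> a * s <= PI / 2 -> cos_moment w s a < 0.
Proof.
intros Ha Has.
assert (Hs := A_radius_pos w s hw).
assert (ID : is_RInt (fun y => - (w y * cos (a * y))) 0 s (- cos_moment w s a)).
{ apply (is_RInt_opp (V := R_NormedModule)), is_RInt_RInt.
  now apply (A_ex_RInt_mode w s hw). }
cut (0 < - cos_moment w s a); [lra|].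
rewrite <- (is_RInt_unique _ _ _ _ ID).
apply RInt_gt_0; [exact Hs|..].
- intros y Hy.
  assert (Hw := A_neg_inside w s hw y ltac:(lra)).
  assert (Hc : 0 < cos (a * y)).
  { generalize PI_RGT_0; intros HPI.
    apply cos_gt_0; [nra|].
    destruct Ha as [Ha| <-]; [nra|lra]. }
  nra.
- intros y _; apply (continuous_opp (V := R_NormedModule)).
  now apply (A_continuous_mode w s hw).
Qed.

Lemma m_w_cos_moment (w : R -> R) (s : R) (hw : assumption_A w s) :
  m_w w = - (2 * cos_moment w s 0).
Proof.
assert (Hs := A_radius_pos w s hw).
assert (Ew : forall y, w y = w y * cos (0 * y)).
{ intros y; rewrite Rmult_0_l, cos_0; ring. }
assert (Iw : forall a b, ex_RInt w a b).
{ intros a b; apply (ex_RInt_continuous (V := R_CompleteNormedModule)).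
  intros; now apply (A_continuous w s hw). }
assert (Eint : RInt w 0 s = cos_moment w s 0).
{ apply RInt_ext; intros; apply Ew. }
unfold m_w; f_equal; apply is_RInt_gen_unique.
unfold is_RInt_gen; apply filterlimi_locally; intros eps.
exists (fun a => a < - s) (fun b => s < b).
- exists (- s); auto.
- exists s; auto.
- intros a b Hab Hb; exists (2 * cos_moment w s 0); split;
    [simpl|apply ball_center].
  assert (Hout : forall c d : R, (forall x, c < x < d -> w x = 0) -> c <= d ->
    is_RInt w c d 0).
  { intros c d Hx Hcd.
    apply (is_RInt_ext (fun _ => 0)).
    - rewrite Rmin_left, Rmax_right by lra; intros x Hcxd; now rewrite Hx.
    - assert (H0 := is_RInt_const (V := R_NormedModule) c d 0).
      unfold scal in H0; simpl in H0; unfold mult in H0; simpl in H0.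
      rewrite Rmult_0_r in H0; exact H0. }
  replace (2 * cos_moment w s 0) with
    (plus (plus 0 (2 * cos_moment w s 0)) 0) by (unfold plus; simpl; ring).
  apply @is_RInt_Chasles with s; [apply @is_RInt_Chasles with (- s)|].
  + apply Hout; [|lra]; intros x Hx.
    rewrite <- (A_even w s hw); apply (A_zero_outside w s hw); lra.
  + rewrite <- Eint; apply is_RInt_even_sym; [apply (A_even w s hw)|apply Iw].
  + apply Hout; [|lra]; intros x Hx; apply (A_zero_outside w s hw); lra.
Qed.

(** By [1 - cos x <= x^2 / 2], and since [w] has constant sign,
    [|J a - J 0| <= |J 0| (a s)^2 / 2] for [J = cos_moment w s]. *)
Lemma cos_moment_continuous_0 (w : R -> R) (s : R) (hw : assumption_A w s) :
  continuous (cos_moment w s) 0.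
Proof.
assert (Hs := A_radius_pos w s hw).
assert (Hneg := cos_moment_neg w s hw 0 ltac:(lra)
  ltac:(generalize PI_RGT_0; lra)).
set (C := - cos_moment w s 0 * (s * s) / 2).
assert (HC : forall a, Rabs (cos_moment w s a - cos_moment w s 0) <= C * (a * a)).
{ intros a; apply Rabs_le.
  assert (HI : is_RInt (fun y => w y * (cos (a * y) - 1)) 0 s
    (cos_moment w s a - cos_moment w s 0)).
  { apply (is_RInt_ext (fun y => minus (w y * cos (a * y)) (w y * cos (0 * y)))).
    { intros y _; rewrite Rmult_0_l, cos_0; unfold minus, plus, opp; simpl; ring. }
    apply (is_RInt_minus (V := R_NormedModule)); apply is_RInt_RInt;
      now apply (A_ex_RInt_mode w s hw). }
  assert (HJ : forall c, is_RInt (fun y => c * (w y * cos (0 * y))) 0 s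
    (c * cos_moment w s 0)).
  { intros c; apply (is_RInt_scal (V := R_NormedModule)), is_RInt_RInt.
    now apply (A_ex_RInt_mode w s hw). }
  assert (Hpt : forall y, 0 < y < s ->
    - (a * a * (s * s) / 2) <= cos (a * y) - 1 <= a * a * (s * s) / 2).
  { intros y Hy; apply Rabs_le_between.
    eapply Rle_trans; [apply Rabs_cos_minus_1_le|].
    assert (y * y <= s * s) by nra. assert (0 <= a * a) by nra. nra. }
  split.
  - replace (- (C * (a * a))) with (a * a * (s * s) / 2 * cos_moment w s 0)
      by (unfold C; field).
    rewrite <- (is_RInt_unique _ _ _ _ HI), <- (is_RInt_unique _ _ _ _ (HJ _)).
    apply RInt_le; [lra|eexists; apply HJ|eexists; apply HI|].
    intros y Hy; rewrite Rmult_0_l, cos_0.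
    generalize (Hpt y Hy) (A_nonpos w s hw y); nra.
  - replace (C * (a * a)) with (- (a * a * (s * s) / 2) * cos_moment w s 0)
      by (unfold C; field).
    rewrite <- (is_RInt_unique _ _ _ _ HI), <- (is_RInt_unique _ _ _ _ (HJ _)).
    apply RInt_le; [lra|eexists; apply HI|eexists; apply HJ|].
    intros y Hy; rewrite Rmult_0_l, cos_0.
    generalize (Hpt y Hy) (A_nonpos w s hw y); nra. }
assert (Hlim : filterlim (fun a => C * (a * a)) (locally 0) (locally 0)).
{ replace 0 with (C * (0 * 0)) at 2 by ring.
  apply (ex_derive_continuous (fun a => C * (a * a))); auto_derive; trivial. }
apply filterlim_locally; intros eps.
apply filterlim_locally with (eps := eps) in Hlim.
revert Hlim; apply filter_imp; intros a Ha.
change (Rabs (C * (a * a) - 0) < eps) in Ha.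
change (Rabs (cos_moment w s a - cos_moment w s 0) < eps).
eapply Rle_lt_trans; [apply HC|].
rewrite Rminus_0_r in Ha; generalize (Rle_abs (C * (a * a))); lra.
Qed.

(** * Minimal mode and asymptotics *)

Lemma minimum_nonzero_modes (w : R -> R) (s : R) (hw : assumption_A w s) (l : R) :
  0 < l -> l * s < / 4 ->
  is_minimum (nonzero_modes w l) (W_hat w 1 l (2 * PI)) /\
  minimum (nonzero_modes w l) = W_hat w 1 l (2 * PI).
Proof.
intros Hl Hls.
assert (HPI := PI_RGT_0).
assert (Hmin : is_minimum (nonzero_modes w l) (W_hat w 1 l (2 * PI))).
{ split.
  - exists (2 * PI); split; [|reflexivity].
    exists 1%Z; split; [discriminate|ring].
  - intros v [k [[n [Hn ->]] ->]].
    replace (2 * PI) with (2 * PI * IZR 1) at 1 by ring.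
    rewrite !(W_hat_cos_moment w s hw) by lra.
    apply Rmult_le_compat_l; [nra|].
    replace (2 * PI * IZR 1 * l) with (2 * PI * l) by ring.
    replace (2 * PI * IZR n * l) with (2 * PI * l * IZR n) by ring.
    apply (cos_moment_multiple_ge w s hw); [nra|nra|exact Hn]. }
split; [exact Hmin|].
apply (iota_unique (V := R_CompleteNormedModule)); [|exact Hmin].
intros v [Hv1 Hv2]; destruct Hmin as [Hm1 Hm2].
apply Rle_antisym; auto.
Qed.

Lemma W_hat_fundamental (w : R -> R) (s : R) (hw : assumption_A w s) (l : R) :
  0 < l -> l * s < / 4 ->
  W_hat w 1 l (2 * PI) = 2 * (l * l) * cos_moment w s (2 * PI * l) /\
  cos_moment w s (2 * PI * l) < 0.
Proof.
intros Hl Hls.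
assert (HPI := PI_RGT_0).
split.
- replace (2 * PI) with (2 * PI * IZR 1) by ring.
  apply (W_hat_cos_moment w s hw); lra.
- apply (cos_moment_neg w s hw); nra.
Qed.

Theorem lemma2p1 (w : R -> R) (s_w : R) (hw : assumption_A w s_w) :
  (forall l : R, 0 < l -> l < 1 / (4 * s_w) ->
     (exists v, is_minimum (nonzero_modes w l) v) /\
     minimum (nonzero_modes w l) <> 0 /\
     gamma_sharp w l = - (1 / W_hat w 1 l (2 * PI))) /\
  0 < m_w w /\
  asymp_equiv (at_right 0) (gamma_sharp w)
    (fun l => 1 / m_w w * powerRZ l (-2)).
Proof.
assert (Hs := A_radius_pos w s_w hw).
assert (HPI := PI_RGT_0).
assert (Hsmall : forall l, l < 1 / (4 * s_w) -> l * s_w < / 4).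
{ intros l Hl; apply Rlt_div_r in Hl; lra. }
assert (Hm : 0 < m_w w).
{ rewrite (m_w_cos_moment w s_w hw).
  assert (H := cos_moment_neg w s_w hw 0 ltac:(lra) ltac:(lra)); lra. }
split; [|split; [exact Hm|]].
- intros l Hl Hl'.
  destruct (minimum_nonzero_modes w s_w hw l Hl (Hsmall l Hl')) as [Hmin Heq].
  destruct (W_hat_fundamental w s_w hw l Hl (Hsmall l Hl')) as [HW Hneg].
  split; [eexists; exact Hmin|].
  unfold gamma_sharp; rewrite Heq; split; [|reflexivity].
  rewrite HW; assert (0 < l * l) by nra; nra.
- assert (HJ0 : cos_moment w s_w 0 <> 0)
    by (generalize (m_w_cos_moment w s_w hw); lra).
  assert (Hlim : continuous
    (fun l => cos_moment w s_w 0 * / cos_moment w s_w (2 * PI * l)) 0).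
  { assert (Hin : continuous (fun l => cos_moment w s_w (2 * PI * l)) 0).
    { apply (continuous_comp (fun l => 2 * PI * l) (cos_moment w s_w)).
      - apply (ex_derive_continuous (fun l => 2 * PI * l)); auto_derive; trivial.
      - rewrite Rmult_0_r; now apply cos_moment_continuous_0. }
    apply (continuous_mult (K := R_AbsRing)); [apply continuous_const|].
    apply continuous_Rinv_comp; [exact Hin|].
    now rewrite Rmult_0_r. }
  unfold continuous in Hlim.
  rewrite Rmult_0_r, Rinv_r in Hlim by exact HJ0.
  unfold asymp_equiv.
  apply (filterlim_ext_loc (fun l =>
    cos_moment w s_w 0 * / cos_moment w s_w (2 * PI * l))).
  + assert (Hd : 0 < 1 / (4 * s_w)) by (apply Rdiv_lt_0_compat; lra).
    exists (mkposreal _ Hd); intros l Hl Hl0.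
    change (Rabs (l - 0) < 1 / (4 * s_w)) in Hl.
    rewrite Rminus_0_r, Rabs_pos_eq in Hl by lra.
    destruct (minimum_nonzero_modes w s_w hw l Hl0 (Hsmall l Hl)) as [_ Heq].
    destruct (W_hat_fundamental w s_w hw l Hl0 (Hsmall l Hl)) as [HW Hneg].
    unfold gamma_sharp.
    rewrite Heq, HW, (m_w_cos_moment w s_w hw).
    simpl; field.
    repeat split; lra.
  + eapply filterlim_filter_le_1; [|exact Hlim].
    apply filter_le_within.
Qed.
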